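(* There exists a covering system of the integers whose moduli are all odd and greater than $1$, in which exactly four congruences have modulus $15$ and the congruences with moduli different from $15$ have pairwise distinct moduli.
   Context: A covering system is a finite collection of congruences $r_i\pmod{m_i}$ such that every integer satisfies at least one of them. *)

(* Defs.v *)
From mathcomp Require Import all_boot all_order all_algebra.

Set Implicit Arguments.
Unset Strict Implicit.
Unset Printing Implicit Defensive.

(* The pair (r, m) stands for the congruence r (mod m). *)
Definition congruence := (int * nat)%type.

Definition modulus (c : congruence) : nat := c.2.

Definition satisfies (x : int) (c : congruence) : bool :=
  (x == c.1 %[mod (modulus c)%:Z])%Z.

Definition covering_system (s : seq congruence) : Prop :=
  all (fun c => 0 < modulus c) s /\
  forall x : int, exists2 c, c \in s & satisfies x c.

(* Different representatives r of the same class modulo m give the same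
   congruence; the normal form identifies them. *)
Definition normal_form (c : congruence) : congruence :=
  ((c.1 %% (modulus c)%:Z)%Z, modulus c).

(* Without this, a list could repeat a congruence, and counting its entries
   would not count congruences. *)
Definition distinct_congruences (s : seq congruence) : bool :=
  uniq [seq normal_form c | c <- s].

(* Main.v *)
(* Split the integers by the leading 3-adic digit, x = 3^k u with u = 1 or 2
   modulo 3.  The classes u = 1 are covered by the moduli 3^(k+1).  On the class
   x = 2 mod 3, the four classes modulo 15 cover all but the residue 4 modulo 5,
   which the modulus 5 covers.  For k > 0 and b coprime to 3, a congruence
   modulo b can be imposed on the class u = 2 three times: through the modulus
   b, through 3b (as 3 divides x), and through 3^(k+1) b, the last one with a
   copy reserved for each k.  So it is enough to cover the integers with moduli
   b > 1 coprime to 6, using each b three times and b = 5 only twice (15 being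
   already spent).  A computer search found such a covering, with all b dividing
   5^2 7^3 11^2 13 17.  The remaining multiples of 3^18 fall to the nineteen
   moduli 19 * 3^i, i = 0..18, one for each residue modulo 19. *)
From Stdlib Require Import ZArith.
Require Import Defs.
From mathcomp Require Import all_boot all_order all_algebra.
From mathcomp Require Import ssrZ zify.

Set Implicit Arguments.
Unset Strict Implicit.
Unset Printing Implicit Defensive.

Import GRing.Theory.

(** * Checking a finite covering by searching digit words *)

(* A step (p, q) reads the digit of weight p in base q; the prime powers
   dividing a modulus thus become prescribed digits, and coverage becomes a
   search in a trie of digit words. *)
Definition digit (s : Z * Z) (x : Z) : Z := Z.modulo (Z.div x s.1) s.2.

Definition word (ss : seq (Z * Z)) (c : Z * Z) : seq (option Z) :=
  [seq if Z.eqb (Z.modulo c.2 (Z.mul s.1 s.2)) Z0 then Some (digit s c.1)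
       else None | s <- ss].

Definition agrees (x : Z) (s : Z * Z) (d : option Z) : bool :=
  if d is Some e then digit s x == e else true.

(* A divisor of m modulo which the digits listed in [word] fix an integer; the
   check below requires it to be m itself. *)
Definition determined (ss : seq (Z * Z)) (m : Z) : Z :=
  foldl (fun g s => if Z.eqb (Z.modulo m (Z.mul s.1 s.2)) Z0
                       && Z.eqb (Z.modulo g s.1) Z0
                    then Z.lcm g (Z.mul s.1 s.2) else g) (Zpos xH) ss.

Definition pos_steps : seq (Z * Z) -> bool :=
  all (fun s => Z.ltb Z0 s.1 && Z.ltb Z0 s.2).

(* The digits not prescribed by any word all lead to the same subtrie, which is
   searched once; this keeps the search small.  The conditionals, unlike boolean
   connectives, are lazy under [vm_compute]. *)
Fixpoint trie_covers (ss : seq (Z * Z)) (L : seq (seq (option Z))) : bool :=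
  if has (all (fun d => ~~ isSome d)) L then true else
  if ss is s :: ss' then
    let fixed := pmap (head None) L in
    let digits := [seq Z.of_nat i | i <- iota 0 (Z.to_nat s.2)] in
    if all (fun e => if e \in fixed then
              trie_covers ss' [seq behead w | w <- L &
                if head None w is Some d then d == e else true]
            else true) digits then
      if all (mem fixed) digits then true
      else trie_covers ss' [seq behead w | w <- L & ~~ isSome (head None w)]
    else false
  else false.

Lemma digit_range (s : Z * Z) (x : Z) : Z.lt 0 s.2 ->
  digit s x \in [seq Z.of_nat i | i <- iota 0 (Z.to_nat s.2)].
Proof.
move=> s_gt0; have := Z.mod_pos_bound (Z.div x s.1) s.2 s_gt0.
rewrite -/(digit s x) => -[d_ge0 d_lt].
apply/mapP; exists (Z.to_nat (digit s x)); last by rewrite Z2Nat.id.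
by rewrite mem_iota; lia.
Qed.

Lemma agrees_none x ss w :
  size w = size ss -> all (fun d => ~~ isSome d) w -> all2 (agrees x) ss w.
Proof. by elim: ss w => [|s ss IH] [|[d|] w] //= [/IH]. Qed.

(** Induction on the steps, following the digit of [x]: a prescribed digit leads into its own
    subtrie, any other digit into the words free at this step. *)
Lemma trie_coversP ss L (x : Z) :
    pos_steps ss -> all (fun w => size w == size ss) L -> trie_covers ss L ->
  exists2 w, w \in L & all2 (agrees x) ss w.
Proof.
elim: ss L => [|s ss IH] L /= pos_ss szL.
  case: hasP => // -[w wL w_none] _; exists w => //.
  by apply: (@agrees_none x [::]) => //; apply/eqP/(allP szL).
case: hasP => [[w wL w_none] _|_].
  exists w => //; apply: (@agrees_none x (s :: ss)) => //.
  exact/eqP/(allP szL).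
case/andP: pos_ss => /andP[_ /Z.ltb_spec0 s_gt0] pos_ss.
case: ifP => // /allP/(_ _ (digit_range x s_gt0)) follow stay.
have lift (L' : seq (seq (option Z))) :
    {subset L' <= L} ->
    (forall w, w \in L' -> agrees x s (head None w)) ->
    trie_covers ss [seq behead w | w <- L'] ->
  exists2 w, w \in L
    & agrees x s (head None w) && all2 (agrees x) ss (behead w).
  move=> sL' agr /IH[] //.
    apply/allP => w' /mapP[w /sL'/(allP szL)/eqP + ->].
    by case: w => //= a w [->].
  by move=> _ /mapP[w wL' ->] ?; exists w; [apply: sL' | rewrite agr].
have [w wL] : exists2 w, w \in L
    & agrees x s (head None w) && all2 (agrees x) ss (behead w).
  case: ifP follow => [_|dN _].
    apply: lift => [w|w]; rewrite mem_filter => /andP[] //.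
    by case: (head None w) => //= d /eqP ->.
  case: ifP stay => [/allP/(_ _ (digit_range x s_gt0))|_].
    by rewrite /= dN.
  apply: lift => [w|w]; rewrite mem_filter => /andP[] //.
  by case: (head None w).
by move=> w_ok; exists w => //; move: (allP szL w wL) w_ok; case: w {wL}.
Qed.

(** The accumulator [g] of the fold keeps dividing [x - r]: if [p] divides [x - r] and the digits of
    weight [p] in base [q] agree, then [p * q] divides it too. *)
Lemma determinedP ss x r m : pos_steps ss ->
  all2 (agrees x) ss (word ss (r, m)) -> Z.divide (determined ss m) (Z.sub x r).
Proof.
rewrite /determined /word; move: (Zpos xH) (Z.divide_1_l (Z.sub x r)).
elim: ss => [|[p q] ss IH] g //= g_dvd pos_ss.
case/andP: pos_ss => /andP[/Z.ltb_spec0 p0 /Z.ltb_spec0 q0] pos_ss /andP[agr].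
apply: IH => //.
case: (Z.eqb _ _) agr => //=; case: Z.eqb_spec => //= g_p /eqP digit_eq.
apply: Z.lcm_least => //.
have [k Dk] : Z.divide p (Z.sub x r).
  apply: Z.divide_trans g_dvd; apply/Z.mod_divide => //=; lia.
move: digit_eq; rewrite /digit /=.
have -> : x = Z.add r (Z.mul k p) by lia.
rewrite Z.div_add; last lia.
move=> E.
have [j Dj] : Z.divide q k.
  (* By [E], [r / p + k] and [r / p] have the same remainder modulo [q], so [k] is [q] times the
     difference of their quotients. *)
  exists (Z.sub (Z.div (Z.add (Z.div r p) k) q) (Z.div (Z.div r p) q)).
  have := Z.div_mod (Z.add (Z.div r p) k) q; have := Z.div_mod (Z.div r p) q.
  move: E; nia.
by exists j; rewrite Dj; ring.
Qed.

Definition covering_check (ss : seq (Z * Z)) (cs : seq (Z * Z)) : bool :=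
  [&& pos_steps ss, all (fun c => Z.eqb (determined ss c.2) c.2) cs
    & trie_covers ss [seq word ss c | c <- cs]].

Lemma covering_checkP ss cs (x : Z) : covering_check ss cs ->
  exists2 c, c \in cs & Z.divide c.2 (Z.sub x c.1).
Proof.
case/and3P=> pos_ss /allP det /(trie_coversP x pos_ss)[].
  by apply/allP => w /mapP[c _ ->]; rewrite size_map.
move=> w /mapP[[r m] cs_c ->] agr; exists (r, m) => //=.
by have /Z.eqb_eq/= <- := det _ cs_c; apply: determinedP agr.
Qed.

(** * The covering with moduli coprime to 6 *)

Local Open Scope Z_scope.

Definition steps : seq (Z * Z) :=
  [:: (1, 5); (5, 5); (1, 7); (7, 7); (49, 7); (1, 11); (11, 11); (1, 17);
      (1, 13)].

(* (b, (r1, r2, r3)): r1 is used modulo b, r2 modulo 3b and r3 modulo each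
   3^(k+1) b.  The repeated residue of b = 5 stands for the missing modulus
   15. *)
Definition table : seq (Z * (Z * Z * Z)) :=
  [:: (5, (4, 4, 3)); (7, (0, 1, 2)); (11, (0, 1, 2)); (13, (0, 1, 2));
      (17, (0, 1, 2)); (25, (20, 15, 10)); (35, (31, 11, 26));
      (49, (6, 13, 20)); (55, (47, 37, 27)); (65, (42, 17, 57));
      (77, (17, 39, 61)); (85, (37, 72, 22)); (91, (45, 32, 19));
      (119, (83, 118, 0)); (121, (10, 21, 32)); (143, (8, 86, 74));
      (175, (80, 130, 5)); (187, (97, 64, 31)); (221, (25, 77, 129));
      (245, (76, 181, 41)); (275, (25, 125, 225)); (325, (250, 225, 200));
      (343, (48, 97, 146)); (385, (227, 172, 117)); (425, (275, 225, 175));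
      (455, (332, 137, 397)); (539, (468, 83, 237)); (605, (527, 417, 307));
      (637, (370, 279, 188)); (715, (152, 712, 647)); (833, (97, 489, 48));
      (847, (318, 802, 439)); (935, (437, 217, 252)); (1001, (206, 570, 921));
      (1105, (142, 857, 402)); (1225, (1105, 230, 580)); (1309, (934, 747, 0));
      (1573, (1308, 593, 945)); (1715, (881, 1616, 636));
      (1925, (150, 1250, 425)); (2057, (604, 1693, 725));
      (2275, (150, 1775, 1125)); (2431, (558, 1273, 2209))] ++
  [:: (2695, (1987, 1602, 1217)); (3025, (2100, 175, 1275));
      (3185, (2477, 1112, 2932)); (3575, (1725, 3000, 75));
      (3773, (3625, 930, 2008)); (4165, (4066, 2351, 1371));
      (4235, (87, 3112, 1902)); (4459, (3282, 2645, 2008));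
      (4675, (250, 1900, 1000)); (5005, (3287, 2637, 4002));
      (5525, (5225, 2625, 3275)); (5831, (2743, 4801, 1028));
      (5929, (76, 3464, 923)); (6545, (1902, 32, 5422));
      (7007, (1350, 713, 6355)); (7865, (6522, 582, 7732));
      (8575, (7055, 930, 3380)); (9163, (4703, 7391, 0));
      (10285, (7622, 4597, 1572)); (11011, (4938, 8942, 9657));
      (12155, (8787, 11712, 0)); (13475, (11150, 5375, 13075));
      (14399, (12099, 7985, 7017)); (15925, (5025, 475, 11850));
      (18865, (17002, 14307, 11612)); (20825, (10730, 13180, 20530));
      (21175, (3475, 6500, 9525)); (22295, (1567, 14307, 4752));
      (25025, (16300, 15650, 2000)); (26741, (11725, 21163, 18732));
      (29155, (21951, 3086, 16806)); (29645, (4927, 26102, 17632));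
      (32725, (30700, 2650, 27675)); (35035, (19732, 18367, 24737));
      (39325, (23825, 25750, 32900)); (41503, (4311, 28027, 10240));
      (45815, (26802, 1812, 35132)); (49049, (30379, 43756, 16365));
      (51425, (15850, 12825, 9800)); (55055, (24672, 25387, 40402));
      (60775, (3925, 6850, 0)); (64141, (1371, 0, 0));
      (71995, (10042, 48157, 17302))] ++
  [:: (75803, (59681, 13033, 0)); (77077, (63139, 56132, 19095));
      (94325, (20775, 74675, 34250)); (100793, (49125, 34726, 20327));
      (111475, (55075, 23225, 102850)); (133705, (89517, 41612, 65922));
      (145775, (74430, 143030, 40130)); (148225, (76075, 97250, 118425));
      (175175, (12725, 151500, 87800)); (187187, (83247, 155242, 184040));
      (207515, (68452, 9162, 157387)); (229075, (219225, 10975, 135925));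
      (245245, (29742, 198547, 64777)); (275275, (2650, 113475, 238600));
      (320705, (67227, 8917, 197567)); (359975, (254825, 148950, 46100));
      (379015, (300467, 329622, 152977)); (385385, (166242, 206282, 276352));
      (503965, (28027, 274427, 58442)); (539539, (8084, 155231, 239315));
      (668525, (437150, 522950, 279850)); (705551, (407483, 599906, 535765));
      (833833, (469566, 405425, 14748)); (935935, (227237, 299232, 700347));
      (1037575, (732500, 880725, 1028950)); (1226225, (863575, 51400, 162875));
      (1310309, (696926, 394547, 1237543));
      (1603525, (259650, 842750, 1031400));
      (1895075, (1134300, 405425, 1365825));
      (1926925, (474550, 899975, 199275));
      (2519825, (1136750, 1383150, 663200));
      (2697695, (386462, 2628702, 1157232));
      (3527755, (1758217, 2399627, 2588277));
      (4169165, (2895262, 329622, 1933147));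
      (4679675, (40050, 2919850, 4256900));
      (6551545, (6522977, 4140597, 4930232));
      (9172163, (7641696, 3536672, 8475529));
      (13488475, (9558625, 6405475, 7631700));
      (17638775, (7402625, 988525, 1177175));
      (20845825, (12067425, 13670950, 15274475));
      (32757725, (2592050, 26415850, 7550850));
      (45860815, (20213332, 34324352, 11875002));
      (229304075, (121107125, 226939775, 204490425))].

Local Close Scope Z_scope.

Definition residue_classes (T : seq (Z * (Z * Z * Z))) : seq (Z * Z) :=
  flatten [seq [:: (t.2.1.1, t.1); (t.2.1.2, t.1); (t.2.2, t.1)] | t <- T].

(** * Lifting the covering through powers of 3 *)

(** Induction on [n]: if [x = q * 3^n], the residue of [q] modulo 3 is either 0 or the leading digit
    [u], with [k = n]. *)
Lemma three_adic_digit (n : nat) (x : int) :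
  (Posz (3 ^ n) %| x)%Z \/
  exists k u : nat, [/\ k < n, (u == 1) || (u == 2)
                & (x == Posz (u * 3 ^ k) %[mod Posz (3 ^ k.+1)])%Z].
Proof.
elim: n => [|n [/dvdzP[q ->]|[k [u [kn u12 xE]]]]]; first by left; apply: dvd1z.
  have qE := divz_eq q 3; have := modz_ge0 q (isT : Posz 3 != Posz 0).
  have := ltz_pmod q (isT : (Posz 0 < Posz 3)%R).
  move: (q %% 3)%Z qE => [[|[|[|//]]]|//] qE _ _.
  - left; apply/dvdzP; exists (q %/ 3)%Z; rewrite expnS; lia.
  - right; exists n, 1; split=> //; rewrite eqz_mod_dvd.
    apply/dvdzP; exists (q %/ 3)%Z; rewrite expnS; lia.
  - right; exists n, 2; split=> //; rewrite eqz_mod_dvd.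
    apply/dvdzP; exists (q %/ 3)%Z; rewrite expnS; lia.
by right; exists k, u; split=> //; apply: ltnW.
Qed.

(* In a row (b, l), the entry (c, r) of index a describes the congruence of
   modulus 3^a b: residue c * 3^(a-1) modulo 3^a and r modulo b. *)
Definition lift_row := (nat * seq (nat * int))%type.

Definition unit_row (n : nat) : lift_row :=
  (1, (0, Posz 0) :: nseq n (1, Posz 0)).

(** A multiple of [3^n] is 0 modulo each [3^i] with [i <= n], so entry [i] only has to catch the
    residue [i] modulo 19. *)
Definition closing_row (n : nat) : lift_row :=
  (19, [seq (0, Posz i) | i <- iota 0 n.+1]).

(** Indices 0 and 1 serve all multiples of 3 at once; index [a >= 2] serves valuation [a - 1] with
    leading digit 2. *)
Definition table_row (n : nat) (t : nat * (int * int * int)) : lift_row :=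
  (t.1, [:: (0, t.2.1.1), (0, t.2.1.2) & nseq n.-1 (2, t.2.2)]).

Definition rows (n : nat) (T : seq (nat * (int * int * int))) : seq lift_row :=
  [:: unit_row n, closing_row n & [seq table_row n t | t <- T]].

Definition key (p : nat * lift_row) : nat * nat := (p.1, p.2.1).

(* The moduli 3^0 * 1 and 3^1 * 5. *)
Definition unused : seq (nat * nat) := [:: (0, 1); (1, 5)].

Definition target (p : nat * lift_row) : nat * int := nth (0, Posz 0) p.2.2 p.1.

(** At index 0 the truncated exponent is harmless, since that residue is taken modulo 1. *)
Definition lifted (p : nat * lift_row) : congruence :=
  (zchinese (3 ^ p.1)%N p.2.1 ((target p).1 * 3 ^ p.1.-1)%N (target p).2,
   3 ^ p.1 * p.2.1).

Definition singles n T : seq congruence :=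
  [seq lifted p | p <- [seq (a, rho) | a <- iota 0 n.+1, rho <- rows n T]
                & key p \notin unused].

Definition fifteens : seq congruence :=
  [:: (Posz 2, 15); (Posz 5, 15); (Posz 8, 15); (Posz 11, 15)].

Lemma satisfies_lifted (x : int) a (rho : lift_row) : coprime 3 rho.1 ->
    (x == ((target (a, rho)).1 * 3 ^ a.-1)%N %[mod (3 ^ a)%N])%Z ->
    (x == (target (a, rho)).2 %[mod rho.1])%Z ->
  satisfies x (lifted (a, rho)).
Proof.
move=> co3 xa xb; rewrite /satisfies /= PoszM.
have co : coprimez (3 ^ a)%N rho.1 by rewrite coprimezE coprimeXl.
rewrite zchinese_remainder //= zchinese_modl // zchinese_modr //.
exact/andP.
Qed.

Lemma lifted_singles n T a rho : a <= n -> rho \in rows n T ->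
  (a, rho.1) \notin unused -> lifted (a, rho) \in singles n T.
Proof.
move=> an rhoT used; apply: map_f; rewrite mem_filter used.
by apply/allpairsP; exists (a, rho); rewrite mem_iota.
Qed.

(** * Distinctness of the moduli *)

(** The 3-adic valuation recovers the exponent; the power of 3 then cancels. *)
Lemma mul3X_inj a b a' b' : coprime 3 b -> coprime 3 b' ->
  3 ^ a * b = 3 ^ a' * b' -> (a, b) = (a', b').
Proof.
have val c d : coprime 3 d -> logn 3 (3 ^ c * d) = c.
  move=> co; rewrite lognM ?expn_gt0 //.
    by rewrite pfactorK // logn_coprime // addn0.
  by case: d co.
move=> co co' E; have Ea : a = a' by rewrite -(val a b) // E val.
by move: E; rewrite Ea => /eqP; rewrite eqn_pmul2l ?expn_gt0 // => /eqP ->.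
Qed.

(** 1 and 19 are the bases of [unit_row] and [closing_row], which the table must avoid. *)
Definition moduli_ok (T : seq (nat * (int * int * int))) : bool :=
  uniq [:: 1, 19 & [seq t.1 | t <- T]] &&
  all (fun t => [&& odd t.1, coprime 3 t.1
                  & (t.1 == 5) ==> (t.2.1.2 == t.2.1.1)]) T.

Definition covers (T : seq (nat * (int * int * int))) : Prop :=
  forall x : int, exists2 t, t \in T &
    [|| (x == t.2.1.1 %[mod t.1])%Z, (x == t.2.1.2 %[mod t.1])%Z
      | (x == t.2.2 %[mod t.1])%Z].

Lemma rows_keys n T :
  [seq rho.1 | rho <- rows n T] = [:: 1, 19 & [seq t.1 | t <- T]].
Proof. by rewrite /rows /= -map_comp. Qed.

Lemma rows_odd_coprime n T rho : moduli_ok T -> rho \in rows n T ->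
  odd rho.1 && coprime 3 rho.1.
Proof.
case/andP=> _ /allP ok; rewrite !inE => /or3P[/eqP-> // | /eqP-> // |].
by case/mapP=> t /ok/and3P[od co _] -> /=; rewrite od.
Qed.

Lemma singlesP n T c : moduli_ok T -> c \in singles n T ->
  exists p, [/\ c = lifted p, odd p.2.1, coprime 3 p.2.1 & key p \notin unused].
Proof.
move=> ok /mapP[p]; rewrite mem_filter.
case/andP=> used /allpairsP[[a rho] /= [_ rhoT Dp]] ->.
have /andP[od co] := rows_odd_coprime ok rhoT.
by exists p; rewrite Dp in used *.
Qed.

(** The modulus determines the key by [mul3X_inj], and the keys come from a product of two
    duplicate-free lists. *)
Lemma uniq_moduli_singles n T : moduli_ok T ->
  uniq [seq modulus c | c <- singles n T].
Proof.
move=> ok; rewrite -map_comp.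
set P := [seq p <- _ | _].
have -> : [seq (modulus \o lifted) p | p <- P]
            = [seq 3 ^ k.1 * k.2 | k <- [seq key p | p <- P]].
  by rewrite -map_comp.
rewrite map_inj_in_uniq => [|[a b] [a' b'] /mapP[p + ->] /mapP[p' + ->]].
  rewrite -(filter_map key (fun k => k \notin unused)) filter_uniq //.
  have -> : [seq key p | p <- [seq (a, rho) | a <- iota 0 n.+1,
                                              rho <- rows n T]]
            = [seq (a, b) | a <- iota 0 n.+1,
                            b <- [:: 1, 19 & [seq t.1 | t <- T]]].
    by rewrite map_allpairs -(rows_keys n) allpairs_mapr.
  rewrite allpairs_uniq ?iota_uniq //; first by case/andP: ok.
  by move=> [? ?] [? ?] _ _ [-> ->].
have co q : q \in P -> coprime 3 q.2.1.
  rewrite mem_filter => /andP[_ /allpairsP[[a1 rho] /= [_ rhoT ->]]].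
  by have /andP[] := rows_odd_coprime ok rhoT.
by move=> /co co1 /co co2 /(mul3X_inj co1 co2).
Qed.

Lemma singles_modulus n T c : moduli_ok T -> c \in singles n T ->
  [/\ odd (modulus c), 1 < modulus c & modulus c != 15].
Proof.
move=> ok /(singlesP ok)[p [-> od co used]].
have od_m : odd (modulus (lifted p)) by rewrite /= oddM oddX od orbT.
split=> //.
  rewrite ltn_neqAle odd_gt0 // andbT; apply: contra used => /eqP E.
  by have [Ea Eb] := @mul3X_inj 0 1 _ _ isT co E; rewrite /key -Ea -Eb.
apply: contra used => /eqP E.
by have [Ea Eb] := @mul3X_inj _ _ 1 5 co isT E; rewrite /key Ea Eb.
Qed.

(** * Coverage and assembly of the system *)

Lemma system_covers n T : 18 <= n -> moduli_ok T ->
    (5, (Posz 4, Posz 4, Posz 3)) \in T -> covers T ->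
  forall x : int, exists2 c, c \in fifteens ++ singles n T & satisfies x c.
Proof.
move=> n18 ok row5 cov x.
have [uT allT] := andP ok.
have inS a rho : a <= n -> rho \in rows n T -> (a, rho.1) \notin unused ->
    (x == Posz ((target (a, rho)).1 * 3 ^ a.-1) %[mod Posz (3 ^ a)])%Z ->
    (x == (target (a, rho)).2 %[mod Posz rho.1])%Z ->
    exists2 c, c \in fifteens ++ singles n T & satisfies x c.
  move=> an rhoT used xa xb; exists (lifted (a, rho)).
    by rewrite mem_cat lifted_singles ?orbT.
  by apply: satisfies_lifted => //; have /andP[] := rows_odd_coprime ok rhoT.
have rowTP t : t \in T -> table_row n t \in rows n T.
  by move=> tT; rewrite 2!in_cons; do 2![apply/orP; right]; apply: map_f.
have notin1 t : t \in T -> (t.1 == 1) = false.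
  move=> tT; apply: contraTF uT => /eqP t1 /=.
  by rewrite !inE -t1 (map_f (fun t => t.1)) ?orbT.
have mod1 (y z : int) : (y == z %[mod Posz 1])%Z by rewrite !modz1.
have [x0|[k [u [kn u12 xE]]]] := three_adic_digit n x.
  (* Multiples of [3^n]: index [i] of the closing row exists because [i <= 18 <= n]. *)
  pose i := absz (x %% 19)%Z.
  have iE : Posz i = (x %% 19)%Z by rewrite gez0_abs // modz_ge0.
  have i19 : i < 19 by rewrite -ltz_nat iE ltz_pmod.
  have i_n : i <= n by apply: leq_trans n18.
  have tE : target (i, closing_row n) = (0, Posz i).
    by rewrite /target (nth_map 0) ?size_iota // nth_iota.
  apply: (inS i (closing_row n)) => //.
  - by rewrite !in_cons eqxx orbT.
  - by rewrite !inE !xpair_eqE !andbF.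
  - rewrite tE mul0n eqz_mod_dvd subr0; apply: dvdz_trans x0.
    by rewrite dvdzE dvdn_exp2l.
  - by rewrite tE iE modz_mod.
(* Leading digit 1 is caught by the unit row; leading digit 2 remains. *)
case/orP: u12 xE => /eqP-> xE.
  apply: (inS k.+1 (unit_row n)) => //; first by rewrite in_cons eqxx.
    by rewrite !inE !xpair_eqE !andbF.
  by rewrite /target /= nth_nseq kn.
case: k kn xE => [_ xE|k kn xE].
  have [x4|x4] := boolP (x == 4 %[mod 5])%Z.
    apply: (inS 0 (table_row n (5, (Posz 4, Posz 4, Posz 3)))) => //.
    exact: rowTP.
  have : [|| x == 2 %[mod 15], x == 5 %[mod 15], x == 8 %[mod 15]
            | x == 11 %[mod 15]]%Z by move: xE x4; rewrite expn1 muln1; lia.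
  by case/or4P=> xr; [exists (Posz 2, 15) | exists (Posz 5, 15)
                     | exists (Posz 8, 15) | exists (Posz 11, 15)];
     rewrite // mem_cat !inE eqxx ?orbT.
(* The valuation is now [k + 1], so the third residue of a table row is used at index [k + 2]. *)
have three_dvd_x : (3 %| x)%Z by move: xE; rewrite eqz_mod_dvd !expnS; lia.
have [t tT /or3P[] xt] := cov x.
- apply: (inS 0 (table_row n t)) => //; first exact: rowTP.
  by rewrite !inE !xpair_eqE /= notin1.
(* The key [(1, 5)] is excluded, but for base 5 the second residue equals the first, so index 0
   takes over. *)
- have [t5|t5] := eqVneq t.1 5.
    apply: (inS 0 (table_row n t)); rewrite ?rowTP // ?inE ?xpair_eqE /= ?t5 //.
    have /and3P[_ _] := allP allT t tT; rewrite t5 /= => /eqP <-.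
    by rewrite -t5.
  apply: (inS 1 (table_row n t)) => //; rewrite ?rowTP //.
  - by apply: leq_trans n18.
  - by rewrite !inE !xpair_eqE /= (negbTE t5).
  - by rewrite mul0n eqz_mod_dvd subr0.
have tE : target (k.+2, table_row n t) = (2, t.2.2).
  by rewrite /target /= nth_nseq -ltnS prednK ?kn //; apply: leq_trans n18.
by apply: (inS k.+2 (table_row n t)); rewrite ?rowTP ?tE.
Qed.

Lemma covering_of_table n T : 18 <= n -> moduli_ok T ->
    (5, (Posz 4, Posz 4, Posz 3)) \in T -> covers T ->
  exists s : seq congruence,
    [/\ covering_system s,
        distinct_congruences s,
        (forall c, c \in s -> odd (modulus c) /\ 1 < modulus c),
        count (fun c => modulus c == 15) s = 4
      & uniq [seq modulus c | c <- s & modulus c != 15]].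
Proof.
move=> n18 ok row5 cov; exists (fifteens ++ singles n T).
have odd_gt1 c :
    c \in fifteens ++ singles n T -> odd (modulus c) /\ 1 < modulus c.
  rewrite mem_cat => /orP[|/(singles_modulus ok)[] //].
  by rewrite !inE => /or4P[] /eqP->.
have all15 : all (fun c => modulus c != 15) (singles n T).
  by apply/allP => c /(singles_modulus ok)[].
split=> //.
- split; last exact: system_covers.
  by apply/allP => c /odd_gt1[_]; apply: ltnW.
- rewrite /distinct_congruences map_cat cat_uniq; apply/and3P; split=> //.
    apply/hasPn => c' /mapP[c cS ->]; apply/negP => /mapP[d d15 [_ E]].
    have := allP all15 c cS; rewrite E.
    by move: d15; rewrite !inE => /or4P[] /eqP->.
  apply: (@map_uniq _ _ modulus); rewrite -map_comp.
  exact: uniq_moduli_singles ok.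
- rewrite count_cat.
  have /eqP -> // : count (fun c => modulus c == 15) (singles n T) == 0.
  by rewrite -leqn0 leqNgt -has_count -all_predC.
- rewrite filter_cat (all_filterP all15); exact: uniq_moduli_singles ok.
Qed.

(** * Transfer from binary integers and evaluation *)

Definition int_row (t : Z * (Z * Z * Z)) : nat * (int * int * int) :=
  (Z.to_nat t.1, (int_of_Z t.2.1.1, int_of_Z t.2.1.2, int_of_Z t.2.2)).

(** Stated over binary integers so that it evaluates on moduli above 10^8. *)
Definition Z_moduli_ok (T : seq (Z * (Z * Z * Z))) : bool :=
  uniq [:: Zpos 1, Zpos 19 & [seq t.1 | t <- T]] &&
  all (fun t => [&& Z.ltb Z0 t.1, Z.odd t.1, ~~ Z.eqb (Z.modulo t.1 (Zpos 3)) Z0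
                  & (Z.eqb t.1 (Zpos 5)) ==> (Z.eqb t.2.1.2 t.2.1.1)]) T.

Lemma moduli_ok_int T : Z_moduli_ok T -> moduli_ok [seq int_row t | t <- T].
Proof.
case/andP=> uT allT; apply/andP; split; last first.
  apply/allP => _ /mapP[[b [[r1 r2] r3]] /(allP allT) /= + ->] /=.
  case/and4P=> b0 b_odd b3 b5; apply/and3P; split.
  - by have [k Dk] := proj1 (Z.odd_spec b) b_odd; lia.
  - rewrite prime_coprime //; apply/negP => /dvdnP[q Dq].
    case: Z.eqb_spec b3 => // [[]].
    have -> : b = Z.mul (Z.of_nat q) (Zpos 3) by lia.
    exact: Z_mod_mult.
  - apply/implyP => /eqP b5'; have /implyP/(_ _)/Z.eqb_spec -> // := b5; lia.
have -> : [:: 1, 19 & [seq t.1 | t <- [seq int_row t | t <- T]]]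
  = [seq Z.to_nat b | b <- [:: Zpos 1, Zpos 19 & [seq t.1 | t <- T]]].
  by rewrite /= -!map_comp.
have pos b : b \in [:: Zpos 1, Zpos 19 & [seq t.1 | t <- T]] -> Z.le Z0 b.
  rewrite !inE => /or3P[/eqP-> //|/eqP-> //|].
  by case/mapP=> t /(allP allT)/and4P[+ _ _ _] ->; lia.
by rewrite map_inj_in_uniq // => b c /pos b0 /pos c0; apply: Z2Nat.inj.
Qed.

Lemma eqz_mod_of_Z (x : int) (r b : Z) : Z.lt Z0 b ->
    Z.divide b (Z.sub (Z_of_int x) r) ->
  (x == int_of_Z r %[mod Posz (Z.to_nat b)])%Z.
Proof.
move=> b0 [k Dk]; rewrite eqz_mod_dvd; apply/dvdzP; exists (int_of_Z k); lia.
Qed.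

Lemma covers_int T :
    Z_moduli_ok T -> covering_check steps (residue_classes T) ->
  covers [seq int_row t | t <- T].
Proof.
case/andP=> _ allT check x.
have [c + dvd_c] := covering_checkP (Z_of_int x) check.
case/flattenP=> _ /mapP[t tT ->] ct.
exists (int_row t); first exact: map_f.
have /and4P[/Z.ltb_spec0 b0 _ _ _] := allP allT t tT.
by move: ct dvd_c; rewrite !inE => /or3P[] /eqP-> /(eqz_mod_of_Z b0) /= ->;
   rewrite ?orbT.
Qed.

Theorem theorem2p6 :
  exists s : seq congruence,
    [/\ covering_system s,
        distinct_congruences s,
        (forall c, c \in s -> odd (modulus c) /\ 1 < modulus c),
        count (fun c => modulus c == 15) s = 4
      & uniq [seq modulus c | c <- s & modulus c != 15]].
Proof.
have ok : Z_moduli_ok table by vm_compute.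
have check : covering_check steps (residue_classes table) by vm_compute.
have row5 : (Zpos 5, (Zpos 4, Zpos 4, Zpos 3)) \in table by exact: mem_head.
(* 18 is the least [n] that gives the closing row nineteen entries. *)
exact: (covering_of_table (leqnn 18) (moduli_ok_int ok) (map_f int_row row5)
          (covers_int ok check)).
Qed.
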